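(* Let $T$ be a (non-degenerate) triangle in the Euclidean plane whose three side lengths and three median lengths are all rational numbers. Then there exists a (non-degenerate) triangle $T'$, not similar to $T$, whose three side lengths and three median lengths are all rational numbers.
   Context: A median of a triangle is the segment joining a vertex to the midpoint of the opposite side. For a triangle with side lengths $a,b,c$, the medians to the sides $a,b,c$ have lengths $m_a=\frac12\sqrt{2b^2+2c^2-a^2}$, $m_b=\frac12\sqrt{2a^2+2c^2-b^2}$, $m_c=\frac12\sqrt{2a^2+2b^2-c^2}$. Similarity of triangles is similarity up to any matching of the vertices. *)

(* Defs.v *)
From mathcomp Require Import all_boot all_order all_algebra perm.
From mathcomp Require Import classical_sets reals.

Set Implicit Arguments.
Unset Strict Implicit.
Unset Printing Implicit Defensive.

Import Order.TTheory GRing.Theory Num.Theory.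

Local Open Scope ring_scope.

(* The norm that MathComp-Analysis puts on row vectors is the sup norm, hence
   this separate Euclidean distance. *)
Definition eucl_dist (R : realType) (P Q : 'rV[R]_2) : R :=
  Num.sqrt (\sum_(k < 2) (P 0 k - Q 0 k) ^+ 2).

Definition triangle (R : realType) : Type := 'I_3 -> 'rV[R]_2.

Definition noncollinear (R : realType) (T : triangle R) : bool :=
  free [:: T 1 - T 0; T 2 - T 0].

Definition side_midpoint (R : realType) (T : triangle R) (i : 'I_3) :
    'rV[R]_2 :=
  2^-1 *: \sum_(j < 3 | j != i) T j.

Definition median_length (R : realType) (T : triangle R) (i : 'I_3) : R :=
  eucl_dist (T i) (side_midpoint T i).

Definition rational_sides (R : realType) (T : triangle R) : Prop :=
  forall i j : 'I_3, rational (eucl_dist (T i) (T j)).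

Definition rational_medians (R : realType) (T : triangle R) : Prop :=
  forall i : 'I_3, rational (median_length T i).

(* The vertices may be matched by any permutation s. *)
Definition similar_triangles (R : realType) (T T' : triangle R) : Prop :=
  exists (s : 'S_3) (k : R), 0 < k /\
    forall i j : 'I_3, eucl_dist (T' (s i)) (T' (s j)) = k * eucl_dist (T i) (T j).

(* Main.v *)
(** The three medians of T, as vectors, sum to zero, hence are the sides of a
    triangle T'; the medians of T' are 3/4 times the sides of T, so T' is again
    rational.  The sum of the squares of the sides of T' is 3/4 of that of T,
    so a similarity from T to T' would have ratio sqrt 3 / 2.  But a similarity
    between triangles with rational sides has rational ratio. *)
Require Import Defs.
From mathcomp Require Import all_boot all_order all_algebra perm.
From mathcomp Require Import classical_sets reals.
From mathcomp Require Import ring lra.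

Set Implicit Arguments.
Unset Strict Implicit.
Unset Printing Implicit Defensive.

Import Order.TTheory GRing.Theory Num.Theory.

Local Open Scope ring_scope.

Lemma ord3_ind (P : 'I_3 -> Prop) : P 0 -> P 1 -> P 2%:R -> forall i, P i.
Proof.
move=> P0 P1 P2 [[|[|[|//]]] i3].
- by rewrite (_ : Ordinal i3 = 0) //; apply: val_inj.
- by rewrite (_ : Ordinal i3 = 1) //; apply: val_inj.
- by rewrite (_ : Ordinal i3 = 2%:R) //; apply: val_inj.
Qed.

(** Addition in ['I_3] is modulo 3, so [i + 1] and [i + 2%:R] are the other two vertices in cyclic
    order. *)
Lemma ord3E : ((1 + 1 = 2%:R :> 'I_3) * (1 + 2%:R = 0 :> 'I_3) *
  (2%:R + 1 = 0 :> 'I_3) * (2%:R + 2%:R = 1 :> 'I_3)).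
Proof. by do !split; apply: val_inj. Qed.

Lemma big_ord3 (V : nmodType) (F : 'I_3 -> V) :
  \sum_i F i = F 0 + F 1 + F 2%:R.
Proof.
rewrite !big_ord_recr big_ord0 /= add0r.
by congr (F _ + F _ + F _); apply: val_inj.
Qed.

(** After clearing denominators, the exponent of 3 is even in [numq q ^+ 2] and odd in
    [3 * denq q ^+ 2]. *)
Lemma rat_sqr_neq3 (q : rat) : q ^+ 2 != 3.
Proof.
apply/eqP => q2.
have : numq q ^+ 2 = 3 * denq q ^+ 2.
  by apply: (@intr_inj rat); rewrite [RHS]intrM !rmorphXn /=
    (_ : 3%:~R = q ^+ 2) -?exprMn -?numqE // q2.
move=> /(congr1 absz); rewrite abszX abszM abszX => /(congr1 (logn 3)).
rewrite lognM ?expn_gt0 ?absz_gt0 ?denq_eq0 // !lognX.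
by move=> /(congr1 odd); rewrite /= oddD !oddM.
Qed.

Lemma free2P (F : fieldType) (V : vectType F) (u v : V) :
  reflect (forall a b, a *: u + b *: v = 0 -> a = 0 /\ b = 0) (free [:: u; v]).
Proof.
apply: (iffP (@freeP _ _ 2 [tuple u; v])) => [uv a b abuv|uv k kuv].
  have h := uv (fun i => if i == 0 then a else b).
  split; [apply: (h _ 0)|apply: (h _ 1)];
    by rewrite !big_ord_recr big_ord0 /= add0r.
move: kuv; rewrite !big_ord_recr big_ord0 /= add0r => /uv[k0 k1].
case=> [[|[|//]] i2]; [rewrite -[RHS]k0|rewrite -[RHS]k1];
  by congr k; apply: val_inj.
Qed.

Section Rational.
Variable R : realType.
Implicit Types x y : R.

Lemma rational_ratr (q : rat) : rational (ratr q : R).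
Proof. by exists q. Qed.

Lemma rationalM x y : rational x -> rational y -> rational (x * y).
Proof. by move=> [p _ <-] [q _ <-]; exists (p * q); rewrite ?rmorphM. Qed.

Lemma rationalV x : rational x -> rational x^-1.
Proof. by move=> [p _ <-]; exists p^-1; rewrite ?fmorphV. Qed.

Lemma rational_sqr_neq3 x : rational x -> x ^+ 2 != 3.
Proof.
move=> [q _ <-]; rewrite -rmorphXn -(ratr_nat R 3) (inj_eq (fmorph_inj _)).
exact: rat_sqr_neq3.
Qed.

End Rational.

Section EuclideanPlane.
Variable R : realType.
Implicit Types (P Q : 'rV[R]_2) (a b : R) (T : triangle R).

Lemma eucl_dist_sqr P Q :
  eucl_dist P Q ^+ 2 = (P 0 0 - Q 0 0) ^+ 2 + (P 0 1 - Q 0 1) ^+ 2.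
Proof.
rewrite sqr_sqrtr ?sumr_ge0 // => [|k _]; last exact: sqr_ge0.
rewrite !big_ord_recr big_ord0 /= add0r.
by congr ((P 0 _ - Q 0 _) ^+ 2 + (P 0 _ - Q 0 _) ^+ 2); apply: val_inj.
Qed.

(** Reduces a comparison of lengths to a linear identity between vectors. *)
Lemma eucl_dist_scale a P Q P' Q' :
  P - Q = a *: (P' - Q') -> eucl_dist P Q = `|a| * eucl_dist P' Q'.
Proof.
move=> /rowP PQ; rewrite /eucl_dist -sqrtr_sqr -sqrtrM ?sqr_ge0 // mulr_sumr.
by congr Num.sqrt; apply: eq_bigr => k _; have := PQ k; rewrite !mxE => ->; ring.
Qed.

Lemma eucl_dist_eq0 P Q : (eucl_dist P Q == 0) = (P == Q).
Proof.
rewrite sqrtr_eq0 le_eqVlt ltNge sumr_ge0 ?orbF => [|k _]; last exact: sqr_ge0.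
rewrite psumr_eq0 => [|k _]; last exact: sqr_ge0.
apply/allP/eqP => [PQ|-> k _]; last by rewrite subrr expr0n eqxx.
apply/rowP => k; have /= := PQ k (mem_index_enum k).
by rewrite sqrf_eq0 subr_eq0 => /eqP.
Qed.

Lemma side_midpointE T i : side_midpoint T i = 2^-1 *: (T (i + 1) + T (i + 2%:R)).
Proof.
rewrite /side_midpoint; congr (_ *: _); rewrite big_mkcond big_ord3.
by elim/ord3_ind: i => /=; rewrite ?add0r ?ord3E ?addr0 // addrC.
Qed.

(* Centred at the origin: 2^-1 *: (T (i + 1) - T (i + 2)) is one third of the
   difference of the median vectors at T (i + 1) and T (i + 2). *)
Definition median_triangle T : triangle R :=
  fun i => 2^-1 *: (T (i + 1) - T (i + 2%:R)).

(** The difference of these two vertices is the midpoint opposite [T (i + 2%:R)] minus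
    [T (i + 2%:R)], whence the factor -1. *)
Lemma median_triangle_side T i :
  eucl_dist (median_triangle T i) (median_triangle T (i + 1)) =
  median_length T (i + 2%:R).
Proof.
rewrite /median_length (@eucl_dist_scale (-1) _ _ (T (i + 2%:R))
  (side_midpoint T (i + 2%:R))) ?normrN1 ?mul1r //.
rewrite side_midpointE /median_triangle -!addrA !ord3E.
by rewrite !addr0; apply/rowP => k; rewrite !mxE; field.
Qed.

(** The vertices of [median_triangle T] sum to zero, so its median vector at a vertex is 3/2 times
    that vertex. *)
Lemma median_triangle_median T i :
  median_length (median_triangle T) i =
  3 / 4 * eucl_dist (T (i + 1)) (T (i + 2%:R)).
Proof.
rewrite /median_length (@eucl_dist_scale (3 / 4) _ _ (T (i + 1))
  (T (i + 2%:R))) ?ger0_norm ?divr_ge0 //.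
rewrite side_midpointE /median_triangle -!addrA !ord3E.
by rewrite !addr0; apply/rowP => k; rewrite !mxE; field.
Qed.

Lemma median_triangle_noncollinear T :
  noncollinear T -> noncollinear (median_triangle T).
Proof.
move=> /free2P fT; apply/free2P => a b; rewrite /median_triangle !add0r !ord3E.
(* The coefficients of the given combination on [T 1 - T 0] and [T 2 - T 0]; as linear forms in [a]
   and [b] they have determinant 3/4, so both vanish only at zero. *)
move=> abT; have [|] := fT (- (2^-1 * a + b)) (a + 2^-1 * b); last by lra.
by rewrite -abT; apply/rowP => k; rewrite !mxE; field.
Qed.

(** Each side counts twice; summing over all ordered pairs makes invariance under relabelling the
    vertices a plain reindexing. *)
Definition sum_sqr_sides T : R := \sum_i \sum_j eucl_dist (T i) (T j) ^+ 2.

Lemma sum_sqr_sides_median_triangle T :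
  sum_sqr_sides (median_triangle T) = 3 / 4 * sum_sqr_sides T.
Proof.
rewrite /sum_sqr_sides !big_ord3 !eucl_dist_sqr /median_triangle !add0r !ord3E.
by rewrite !mxE; field.
Qed.

Lemma noncollinear_dist_gt0 T : noncollinear T -> 0 < eucl_dist (T 1) (T 0).
Proof.
move=> /free2P fT; rewrite lt0r sqrtr_ge0 andbT eucl_dist_eq0 -subr_eq0.
apply/eqP => T10; have [|/eqP] := fT 1 0; last by rewrite oner_eq0.
by rewrite T10 scaler0 scale0r addr0.
Qed.

Lemma sum_sqr_sides_gt0 T : noncollinear T -> 0 < sum_sqr_sides T.
Proof.
move=> /noncollinear_dist_gt0 d_gt0.
rewrite /sum_sqr_sides (bigD1 1) //= (bigD1 0) //= -addrA ltr_wpDr ?exprn_gt0 //.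
by rewrite addr_ge0 ?sumr_ge0 // => i _; rewrite ?sumr_ge0 // => *; exact: sqr_ge0.
Qed.

Lemma sum_sqr_sides_similar T T' (s : 'S_3) k :
  (forall i j, eucl_dist (T' (s i)) (T' (s j)) = k * eucl_dist (T i) (T j)) ->
  sum_sqr_sides T' = k ^+ 2 * sum_sqr_sides T.
Proof.
move=> sim; rewrite /sum_sqr_sides mulr_sumr (reindex_inj (@perm_inj _ s)) /=.
apply: eq_bigr => i _; rewrite mulr_sumr (reindex_inj (@perm_inj _ s)) /=.
by apply: eq_bigr => j _; rewrite sim exprMn.
Qed.

Lemma rational_sides_median_triangle T :
  rational_medians T -> rational_sides (median_triangle T).
Proof.
move=> mT.
have side i : rational
    (eucl_dist (median_triangle T i) (median_triangle T (i + 1))).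
  by rewrite median_triangle_side.
have eucl_distC P Q : eucl_dist P Q = eucl_dist Q P.
  by rewrite (@eucl_dist_scale (-1) P Q Q P) ?normrN1 ?mul1r // scaleN1r opprB.
(* Any two vertices of a triangle are equal or cyclically adjacent. *)
move=> i j; have [->|->|->] : [\/ j = i, j = i + 1 | i = j + 1].
  by elim/ord3_ind: i; elim/ord3_ind: j; do ?[by constructor 1 | by
    constructor 2; apply: val_inj | by constructor 3; apply: val_inj].
- have /eqP -> : eucl_dist (median_triangle T i) (median_triangle T i) == 0.
    by rewrite eucl_dist_eq0.
  by rewrite -(rmorph0 (@ratr R)); exact: rational_ratr.
- exact: side.
- by rewrite eucl_distC; exact: side.
Qed.

Lemma rational_medians_median_triangle T :
  rational_sides T -> rational_medians (median_triangle T).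
Proof.
move=> sT i; rewrite median_triangle_median; apply: rationalM => //.
by rewrite -!(ratr_nat R) -fmorph_div; exact: rational_ratr.
Qed.

Lemma median_triangle_not_similar T :
  noncollinear T -> rational_sides T -> rational_medians T ->
  ~ similar_triangles T (median_triangle T).
Proof.
move=> ndT sT mT [s [k [_ sim]]].
have k_rat : rational k.
  have d0 := lt0r_neq0 (noncollinear_dist_gt0 ndT).
  (* [k] is the quotient of a side of [median_triangle T] by the nonzero side from [T 1] to
     [T 0]. *)
  rewrite -(mulfK d0 k) -sim; apply: rationalM; last exact: rationalV.
  exact: rational_sides_median_triangle.
have := sum_sqr_sides_similar sim; rewrite sum_sqr_sides_median_triangle.
move=> /(mulIf (lt0r_neq0 (sum_sqr_sides_gt0 ndT))) k2.
(* Cancelling the positive sum left [k ^+ 2] equal to 3/4, so the rational [2 * k] would be a square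
   root of 3. *)
have /eqP[] : (2 * k) ^+ 2 != 3.
  apply: rational_sqr_neq3; apply: rationalM => //.
  by rewrite -(ratr_nat R); exact: rational_ratr.
by rewrite exprMn -k2; field.
Qed.

End EuclideanPlane.

Theorem mainTheorem1 (R : realType) (T : triangle R)
    (ndT : noncollinear T)
    (sidesT : rational_sides T) (mediansT : rational_medians T) :
  exists T' : triangle R,
    [/\ noncollinear T', rational_sides T', rational_medians T'
      & ~ similar_triangles T T'].
Proof.
exists (median_triangle T); split.
- exact: median_triangle_noncollinear.
- exact: rational_sides_median_triangle.
- exact: rational_medians_median_triangle.
- exact: median_triangle_not_similar.
Qed.
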